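(* Let $\mathbb{K}$ be a unital commutative ring and let $V$ be the free $\mathbb{K}$-module on $\{x,y\}$. Let $e(z):=1+\sum_{n\ge1}z^{\prec n}$, and let $H_n(x,y)$, $n\ge 2$, be the dendriform polynomials, homogeneous of total degree $n$ in $x,y$, determined by $$e(x)\,e(y)=e\Big(x+y+\sum_{n\ge 2}H_n(x,y)\Big)$$ in the completed free unital dendriform algebra $\mathbb{K}\,1\oplus Dend(V)^{\wedge}$. Then for every $n\ge 2$, $H_n$ is the brace product: $$H_n(x,y)=\sum_{i+j=n-1}(-1)^j\,(x^{\prec i})\succ y\prec(x^{\succ j})=\{\underbrace{x,\ldots,x}_{n-1};y\},$$ where the sum is over integers $i,j\ge 0$.
   Context: A dendriform algebra over $\mathbb{K}$ is a $\mathbb{K}$-module $A$ with two bilinear operations $\prec,\succ:A\otimes A\to A$ such that $(x\prec y)\prec z=x\prec(y\prec z)+x\prec(y\succ z)$, $(x\succ y)\prec z=x\succ(y\prec z)$, $(x\prec y)\succ z+(x\succ y)\succ z=x\succ(y\succ z)$. The product $xy:=x\prec y+x\succ y$ is associative. $Dend(V)=\bigoplus_{n\ge 1}Dend_n\otimes V^{\otimes n}$ is the free dendriform algebra on $V$, graded by degree $n$, and $Dend(V)^{\wedge}=\prod_{n\ge 1}Dend_n\otimes V^{\otimes n}$ is its completion. A unit $1$ is adjoined by $u\prec 1=u$, $1\prec u=0$, $u\succ 1=0$, $1\succ u=u$ for $u\in Dend(V)^{\wedge}$, while $1\prec1$ and $1\succ 1$ are not defined; the associative product is extended so that $1$ is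 a two-sided unit. For $z\in Dend(V)^{\wedge}$: $z^{\prec 0}=z^{\succ 0}=1$, $z^{\prec 1}=z^{\succ 1}=z$, $z^{\prec n}=z\prec(z^{\prec n-1})$, $z^{\succ n}=(z^{\succ n-1})\succ z$. An expression $a\succ z\prec b$ means $(a\succ z)\prec b=a\succ(z\prec b)$, with the unit rules applied when $a$ or $b$ is $1$. The brace products in a dendriform algebra are the $(m+1)$-ary operations $$\{x_1,\ldots,x_m;y\}:=\sum_{i=0}^{m}(-1)^{m-i}\big(x_1\prec(x_2\prec(\cdots\prec x_i))\big)\succ y\prec\big(((x_{i+1}\succ\cdots)\succ x_{m-1})\succ x_m\big),$$ where an empty bracket (for $i=0$ on the left, $i=m$ on the right) is $1$. *)

(* Defs.v *)
From HB Require Import structures.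
From mathcomp Require Import all_boot all_algebra.
From mathcomp Require Import generic_quotient zify.
From mathcomp Require Import boolp classical_sets functions.

Set Implicit Arguments.
Unset Strict Implicit.
Unset Printing Implicit Defensive.

Import GRing.Theory.
Local Open Scope ring_scope.
Local Open Scope quotient_scope.

HB.mixin Record isDendriform (K : comPzRingType) A of GRing.Lmodule K A := {
  prec : A -> A -> A;
  succ : A -> A -> A;
  prec_linearl : forall z, linear (fun x => prec x z);
  prec_linearr : forall x, linear (prec x);
  succ_linearl : forall z, linear (fun x => succ x z);
  succ_linearr : forall x, linear (succ x);
  dend_prec_prec : forall x y z,
    prec (prec x y) z = prec x (prec y z) + prec x (succ y z);
  dend_succ_prec : forall x y z, prec (succ x y) z = succ x (prec y z);
  dend_succ_succ : forall x y z,
    succ (prec x y) z + succ (succ x y) z = succ x (succ y z)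
}.

#[short(type="dendType")]
HB.structure Definition Dendriform (K : comPzRingType) :=
  {A of isDendriform K A & GRing.Lmodule K A}.

Declare Scope dend_scope.
Delimit Scope dend_scope with dend.
Notation "x ≺ y" := (prec x y) (at level 45, no associativity) : dend_scope.
Notation "x ≻ y" := (succ x y) (at level 45, no associativity) : dend_scope.
Local Open Scope dend_scope.

(* The pair (c, u) stands for c 1 + u in K 1 (+) D.  Since 1 ≺ 1 and 1 ≻ 1 are
   undefined, the half-products only accept the unit on the side where the
   products a ≻ z ≺ b need it, the other argument being in D. *)
Section Unit.
Variables (K : comPzRingType) (D : dendType K).

Definition augmented : Type := (K * D)%type.

Definition aone : augmented := (1, 0).
Definition ain (u : D) : augmented := (0, u).

(* z ≺ 1 = z *)
Definition precU (z : D) (b : augmented) : D := b.1 *: z + (z ≺ b.2).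
(* 1 ≻ z = z *)
Definition succU (a : augmented) (z : D) : D := a.1 *: z + (a.2 ≻ z).

Definition amul (a b : augmented) : augmented :=
  (a.1 * b.1, a.1 *: b.2 + b.1 *: a.2 + ((a.2 ≺ b.2) + (a.2 ≻ b.2))).

Definition midU (a : augmented) (z : D) (b : augmented) : D :=
  precU (succU a z) b.

Lemma midU_assoc a z b : midU a z b = succU a (precU z b).
Proof.
rewrite /midU /precU /succU.
have -> : (a.1 *: z + (a.2 ≻ z)) ≺ b.2
    = a.1 *: (z ≺ b.2) + ((a.2 ≻ z) ≺ b.2) by rewrite prec_linearl.
have -> : (a.2 ≻ (b.1 *: z + (z ≺ b.2)))
    = b.1 *: (a.2 ≻ z) + (a.2 ≻ (z ≺ b.2)) by rewrite succ_linearr.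
by rewrite dend_succ_prec !scalerDr !scalerA mulrC addrACA.
Qed.

Fixpoint precpow (z : D) (n : nat) : augmented :=
  if n is m.+1 then ain (precU z (precpow z m)) else aone.

Fixpoint succpow (z : D) (n : nat) : augmented :=
  if n is m.+1 then ain (succU (succpow z m) z) else aone.

(* x_1 ≺ (x_2 ≺ (... ≺ x_i)), and 1 for the empty sequence *)
Definition prec_nest (s : seq D) : augmented :=
  foldr (fun u a => ain (precU u a)) aone s.

(* ((x_1 ≻ x_2) ≻ ...) ≻ x_j, and 1 for the empty sequence *)
Definition succ_nest (s : seq D) : augmented :=
  foldl (fun a u => ain (succU a u)) aone s.

Definition brace (s : seq D) (y : D) : D :=
  \sum_(i < (size s).+1)
    (-1) ^+ (size s - i) *: midU (prec_nest (take i s)) y (succ_nest (drop i s)).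

End Unit.

Arguments aone {K D}.

Definition dend_morphism (K : comPzRingType) (A B : dendType K)
    (f : {linear A -> B}) : Prop :=
  (forall a b, f (a ≺ b) = (f a ≺ f b)) /\ (forall a b, f (a ≻ b) = (f a ≻ f b)).

Definition free_dendriform (K : comPzRingType) (V : lmodType K) (A : dendType K)
    (iota : {linear V -> A}) : Prop :=
  forall (B : dendType K) (f : {linear V -> B}),
    exists g : {linear A -> B},
      [/\ dend_morphism g, forall v, g (iota v) = f v &
          forall g' : {linear A -> B},
            dend_morphism g' -> (forall v, g' (iota v) = f v) -> g' =1 g].

Definition free_module_on2 (K : comPzRingType) (V : lmodType K) (x y : V) : Prop :=
  forall v : V, exists! c : K * K, v = c.1 *: x + c.2 *: y.

Section Completion.
Variables (K : comPzRingType) (V : lmodType K) (A : dendType K).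
Variable iota : {linear V -> A}.

(* homog n is the K-span of the n-fold products of elements of V; when A is
   free on V it is the summand Dend_n (x) V^{(x) n} of Dend(V). *)
Inductive homog : nat -> A -> Prop :=
| homog_gen v : homog 1 (iota v)
| homog_zero n : homog n 0
| homog_add n a b : homog n a -> homog n b -> homog n (a + b)
| homog_scale n c a : homog n a -> homog n (c *: a)
| homog_prec m n a b : homog m a -> homog n b -> homog (m + n) (a ≺ b)
| homog_succ m n a b : homog m a -> homog n b -> homog (m + n) (a ≻ b).

Lemma prec0 (D : dendType K) (a : D) : (0 ≺ a) = 0.
Proof.
have := prec_linearl a (-1) 0 0; rewrite scaler0 addr0 => ->.
by rewrite scaleN1r addNr.
Qed.

Lemma succ0 (D : dendType K) (a : D) : (0 ≻ a) = 0.
Proof.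
have := succ_linearl a (-1) 0 0; rewrite scaler0 addr0 => ->.
by rewrite scaleN1r addNr.
Qed.

Lemma precr0 (D : dendType K) (a : D) : (a ≺ 0) = 0.
Proof.
have := prec_linearr a (-1) 0 0; rewrite scaler0 addr0 => ->.
by rewrite scaleN1r addNr.
Qed.

Lemma succr0 (D : dendType K) (a : D) : (a ≻ 0) = 0.
Proof.
have := succ_linearr a (-1) 0 0; rewrite scaler0 addr0 => ->.
by rewrite scaleN1r addNr.
Qed.

Lemma homog0 a : homog 0 a -> a = 0.
Proof.
move=> h; have := erefl 0%N; move: h; move: {1 3}0%N => n; elim=> //=.
- by move=> m u v _ IHu _ IHv m0; rewrite IHu ?IHv ?addr0.
- by move=> m c u _ IHu m0; rewrite IHu ?scaler0.
- by move=> m k u v _ IHu _ _ /esym/eqP; rewrite addn_eq0 => /andP[/eqP m0 _];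
     rewrite IHu ?prec0.
- by move=> m k u v _ IHu _ _ /esym/eqP; rewrite addn_eq0 => /andP[/eqP m0 _];
     rewrite IHu ?succ0.
Qed.

Lemma homog_sum n (I : Type) (r : seq I) (P : pred I) (F : I -> A) :
  (forall i, P i -> homog n (F i)) -> homog n (\sum_(i <- r | P i) F i).
Proof.
by move=> hF; apply: (big_ind (homog n)) => //; [exact: homog_zero|exact: homog_add].
Qed.

(* An element of prod_(n >= 1) Dend_n (x) V^{(x) n} is the sequence of its
   homogeneous components; the component of index 0 vanishes by homog0. *)
Definition graded_series : {pred nat -> A} :=
  fun a => `[< forall n, homog n (a n) >].

Lemma graded_seriesP (a : nat -> A) :
  reflect (forall n, homog n (a n)) (a \in graded_series).
Proof. exact: asboolP. Qed.

Fact graded_series_closed : submod_closed graded_series.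
Proof.
split; first by apply/graded_seriesP => n; exact: homog_zero.
move=> c a b /graded_seriesP ha /graded_seriesP hb; apply/graded_seriesP => n.
by apply: homog_add (hb n); apply: homog_scale.
Qed.

HB.instance Definition _ :=
  GRing.isSubmodClosed.Build K (nat -> A) graded_series graded_series_closed.

Record completion : Type := Completion {
  component :> nat -> A;
  completionP : component \in graded_series }.

HB.instance Definition _ := [isSub for component].
HB.instance Definition _ := [Choice of completion by <:].
HB.instance Definition _ := [SubChoice_isSubLmodule of completion by <:].

Lemma component_homog (a : completion) n : homog n (a n).
Proof. exact/graded_seriesP/completionP. Qed.

Lemma completion_eq (a b : completion) : (forall n, a n = b n) -> a = b.
Proof. by move=> ab; apply: val_inj; apply: funext. Qed.

Lemma componentD (a b : completion) n : (a + b) n = a n + b n.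
Proof. by []. Qed.

Lemma componentZ c (a : completion) n : (c *: a) n = c *: a n.
Proof. by []. Qed.

Definition conv (op : A -> A -> A) (a b : nat -> A) (n : nat) : A :=
  \sum_(i < n.+1) op (a i) (b (n - i)%N).

Fact cprec_subproof (a b : completion) : conv prec a b \in graded_series.
Proof.
apply/graded_seriesP => n; apply: homog_sum => i _.
by rewrite -{1}(subnKC (ltn_ord i : i <= n)%N);
   apply: homog_prec; exact: component_homog.
Qed.

Fact csucc_subproof (a b : completion) : conv succ a b \in graded_series.
Proof.
apply/graded_seriesP => n; apply: homog_sum => i _.
by rewrite -{1}(subnKC (ltn_ord i : i <= n)%N);
   apply: homog_succ; exact: component_homog.
Qed.

Definition cprec a b : completion := Completion (cprec_subproof a b).
Definition csucc a b : completion := Completion (csucc_subproof a b).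

Fact conv_linearl (op : A -> A -> A) (opl : forall z, linear (fun x => op x z))
    (c : K) (a a' b : nat -> A) n :
  conv op (c *: a + a') b n = c *: conv op a b n + conv op a' b n.
Proof. by rewrite scaler_sumr -big_split; apply: eq_bigr => i _; exact: opl. Qed.

Fact conv_linearr (op : A -> A -> A) (opr : forall x, linear (op x))
    (c : K) (a b b' : nat -> A) n :
  conv op a (c *: b + b') n = c *: conv op a b n + conv op a b' n.
Proof. by rewrite scaler_sumr -big_split; apply: eq_bigr => i _; exact: opr. Qed.

Fact cprec_linearl z : linear (fun a => cprec a z).
Proof. by move=> c a b; apply: completion_eq => n; exact/conv_linearl/prec_linearl. Qed.

Fact cprec_linearr a : linear (cprec a).
Proof. by move=> c b d; apply: completion_eq => n; exact/conv_linearr/prec_linearr. Qed.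

Fact csucc_linearl z : linear (fun a => csucc a z).
Proof. by move=> c a b; apply: completion_eq => n; exact/conv_linearl/succ_linearl. Qed.

Fact csucc_linearr a : linear (csucc a).
Proof. by move=> c b d; apply: completion_eq => n; exact/conv_linearr/succ_linearr. Qed.

Fact linear_sum (f : A -> A) (fl : linear f) n (F : 'I_n -> A) :
  f (\sum_i F i) = \sum_i f (F i).
Proof.
apply: (big_morph f) => [u v|]; first by have := fl 1 u v; rewrite !scale1r.
by have := fl (-1) 0 0; rewrite scaler0 addr0 => ->; rewrite scaleN1r addNr.
Qed.

Fact triangle_sum (F : nat -> nat -> nat -> A) n :
  \sum_(i < n.+1) \sum_(j < i.+1) F j (i - j)%N (n - i)%N
  = \sum_(j < n.+1) \sum_(k < (n - j).+1) F j k (n - j - k)%N.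
Proof.
transitivity (\sum_(i < n.+1) \sum_(j < n.+1 | (j <= i)%N)
                F j (i - j)%N (n - i)%N).
  apply: eq_bigr => i _.
  by rewrite (big_ord_widen n.+1 (fun j => F j (i - j)%N (n - i)%N) (ltn_ord i)).
rewrite (exchange_big_dep xpredT) //=; apply: eq_bigr => j _.
rewrite -(big_mkord (fun i => j <= i)%N (fun i => F j (i - j)%N (n - i)%N)).
rewrite -(big_mkord xpredT (fun k => F j k (n - j - k)%N)).
rewrite (big_cat_nat (n := j)) //=; last by rewrite ltnW.
rewrite big_nat_cond big1 ?add0r; last first.
  by move=> i /andP[/andP[_ ij]]; rewrite leqNgt ij.
rewrite big_nat_cond (eq_bigl (fun i => (j <= i < n.+1)%N)); last first.
  by move=> i; case: (j <= i)%N; rewrite ?andbT ?andbF.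
rewrite -big_nat -{1}(add0n (j : nat)) big_addn subSn ?leq_ord //.
by apply: eq_bigr => k _; rewrite addnK addnC subnDA.
Qed.

Fact convl (o1 o2 : A -> A -> A) (ol : forall z, linear (fun x => o1 x z))
    (a b c : nat -> A) n :
  conv o1 (conv o2 a b) c n
  = \sum_(i < n.+1) \sum_(j < (n - i).+1) o1 (o2 (a i) (b j)) (c (n - i - j)%N).
Proof.
rewrite -(triangle_sum (fun i j k => o1 (o2 (a i) (b j)) (c k))).
by apply: eq_bigr => i _; rewrite /conv (linear_sum (ol _)).
Qed.

Fact convr (o1 o2 : A -> A -> A) (or : forall x, linear (o1 x))
    (a b c : nat -> A) n :
  conv o1 a (conv o2 b c) n
  = \sum_(i < n.+1) \sum_(j < (n - i).+1) o1 (a i) (o2 (b j) (c (n - i - j)%N)).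
Proof. by apply: eq_bigr => i _; rewrite /conv (linear_sum (or _)). Qed.

Fact cprec_prec a b c :
  cprec (cprec a b) c = cprec a (cprec b c) + cprec a (csucc b c).
Proof.
apply: completion_eq => n; rewrite componentD /=.
rewrite (convl _ prec_linearl) !(convr _ prec_linearr) -big_split /=.
apply: eq_bigr => i _; rewrite -big_split /=.
by apply: eq_bigr => j _; rewrite dend_prec_prec.
Qed.

Fact csucc_prec a b c : cprec (csucc a b) c = csucc a (cprec b c).
Proof.
apply: completion_eq => n /=.
rewrite (convl _ prec_linearl) (convr _ succ_linearr).
by apply: eq_bigr => i _; apply: eq_bigr => j _; rewrite dend_succ_prec.
Qed.

Fact csucc_succ a b c :
  csucc (cprec a b) c + csucc (csucc a b) c = csucc a (csucc b c).
Proof.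
apply: completion_eq => n; rewrite componentD /=.
rewrite !(convl _ succ_linearl) (convr _ succ_linearr) -big_split /=.
apply: eq_bigr => i _; rewrite -big_split /=.
by apply: eq_bigr => j _; rewrite dend_succ_succ.
Qed.

HB.instance Definition _ := isDendriform.Build K completion
  cprec_linearl cprec_linearr csucc_linearl csucc_linearr
  cprec_prec csucc_prec csucc_succ.

Fact cgen_subproof (v : V) :
  (fun n => if n == 1%N then iota v else 0) \in graded_series.
Proof.
by apply/graded_seriesP => n; case: eqP => [->|_]; [exact: homog_gen|exact: homog_zero].
Qed.

Definition cgen (v : V) : completion := Completion (cgen_subproof v).

(* Sum over n >= 1 of a family u whose n-th term has no component of degree
   < n: only the terms of index <= d contribute in degree d (see infsumE). *)
Fact infsum_subproof (u : nat -> completion) :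
  (fun d => \sum_(1 <= n < d.+1) u n d) \in graded_series.
Proof. by apply/graded_seriesP => d; apply: homog_sum => n _; exact: component_homog. Qed.

Definition infsum (u : nat -> completion) : completion :=
  Completion (infsum_subproof u).

Fact component_sum (I : Type) (r : seq I) (F : I -> completion) d :
  (\sum_(i <- r) F i) d = \sum_(i <- r) F i d.
Proof. exact: (big_morph (fun a : completion => a d)). Qed.

Lemma infsumE (u : nat -> completion) :
  (forall n d, (d < n)%N -> u n d = 0) ->
  forall d N, (d <= N)%N -> (\sum_(1 <= n < N.+1) u n) d = infsum u d.
Proof.
move=> u0 d N dN; rewrite component_sum /= [LHS](big_cat_nat (n := d.+1)) //=.
rewrite [X in _ + X]big_nat_cond [X in _ + X]big1 ?addr0 //.
by move=> n /andP[/andP[dn _] _]; exact: u0.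
Qed.

Lemma precpow_low (z : completion) n d : (d < n)%N -> (precpow z n).2 d = 0.
Proof.
have z0 : z 0%N = 0 by apply: homog0; exact: component_homog.
elim: n d => // n IHn d; rewrite ltnS => dn.
rewrite -[LHS]/(((precpow z n).1 *: z + (z ≺ (precpow z n).2)) d).
rewrite componentD componentZ.
have -> : (precpow z n).1 *: z d = 0.
  by case: n dn {IHn} => [|n] /=; [case: d => // _; rewrite z0 scaler0|rewrite scale0r].
rewrite add0r /= /conv big1 // => i _.
have [->|i_gt0] := posnP i; first by rewrite z0 prec0.
by rewrite IHn ?precr0 //; have := ltn_ord i; lia.
Qed.

Definition dexp (z : completion) : augmented completion :=
  (1, infsum (fun n => (precpow z n).2)).

Fact series_ge2_subproof (H : nat -> A) :
  (forall n, (2 <= n)%N -> homog n (H n)) ->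
  (fun n => if (2 <= n)%N then H n else 0) \in graded_series.
Proof.
move=> hH; apply/graded_seriesP => n.
by case: ifP => [/hH //|_]; exact: homog_zero.
Qed.

Definition series_ge2 (H : nat -> A)
    (hH : forall n, (2 <= n)%N -> homog n (H n)) : completion :=
  Completion (series_ge2_subproof hH).

(* The values H 0 and H 1 are irrelevant. *)
Definition is_BCH (x y : V) (H : nat -> A) : Prop :=
  exists hH : forall n, (2 <= n)%N -> homog n (H n),
    amul (dexp (cgen x)) (dexp (cgen y))
    = dexp (cgen x + cgen y + series_ge2 hH).

End Completion.

(* Dend V is defined by generators and relations; free_Dend shows that the
   hypothesis free_dendriform is satisfiable over every module V. *)
Section Existence.
Variables (K : comPzRingType) (V : lmodType K).

Inductive dterm : Type :=
| DGen of V | DZero | DAdd of dterm & dterm | DOpp of dterm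
| DScale of K & dterm | DPrec of dterm & dterm | DSucc of dterm & dterm.

Inductive deq : dterm -> dterm -> Prop :=
| deq_refl t : deq t t
| deq_sym t u : deq t u -> deq u t
| deq_trans t u v : deq t u -> deq u v -> deq t v
| deq_add t t' u u' : deq t t' -> deq u u' -> deq (DAdd t u) (DAdd t' u')
| deq_opp t t' : deq t t' -> deq (DOpp t) (DOpp t')
| deq_scale c t t' : deq t t' -> deq (DScale c t) (DScale c t')
| deq_prec t t' u u' : deq t t' -> deq u u' -> deq (DPrec t u) (DPrec t' u')
| deq_succ t t' u u' : deq t t' -> deq u u' -> deq (DSucc t u) (DSucc t' u')
| deq_addA t u v : deq (DAdd t (DAdd u v)) (DAdd (DAdd t u) v)
| deq_addC t u : deq (DAdd t u) (DAdd u t)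
| deq_add0 t : deq (DAdd DZero t) t
| deq_addN t : deq (DAdd (DOpp t) t) DZero
| deq_scaleA c d t : deq (DScale c (DScale d t)) (DScale (c * d) t)
| deq_scale1 t : deq (DScale 1 t) t
| deq_scaleDr c t u : deq (DScale c (DAdd t u)) (DAdd (DScale c t) (DScale c u))
| deq_scaleDl t c d : deq (DScale (c + d) t) (DAdd (DScale c t) (DScale d t))
| deq_gen c v w : deq (DGen (c *: v + w)) (DAdd (DScale c (DGen v)) (DGen w))
| deq_precl z c t u :
    deq (DPrec (DAdd (DScale c t) u) z) (DAdd (DScale c (DPrec t z)) (DPrec u z))
| deq_precr z c t u :
    deq (DPrec z (DAdd (DScale c t) u)) (DAdd (DScale c (DPrec z t)) (DPrec z u))
| deq_succl z c t u :
    deq (DSucc (DAdd (DScale c t) u) z) (DAdd (DScale c (DSucc t z)) (DSucc u z))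
| deq_succr z c t u :
    deq (DSucc z (DAdd (DScale c t) u)) (DAdd (DScale c (DSucc z t)) (DSucc z u))
| deq_dend_pp t u v : deq (DPrec (DPrec t u) v)
    (DAdd (DPrec t (DPrec u v)) (DPrec t (DSucc u v)))
| deq_dend_sp t u v : deq (DPrec (DSucc t u) v) (DSucc t (DPrec u v))
| deq_dend_ss t u v : deq (DAdd (DSucc (DPrec t u) v) (DSucc (DSucc t u) v))
    (DSucc t (DSucc u v)).

Definition deqb : rel {classic dterm} := fun t u => `[< deq t u >].

Fact deqb_equiv : equiv_class_of deqb.
Proof.
split=> [t|t u|u t v]; first by apply/asboolP; exact: deq_refl.
  by apply/asboolP/asboolP; exact: deq_sym.
by move=> /asboolP tu /asboolP uv; apply/asboolP; exact: deq_trans tu uv.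
Qed.

Definition deq_equiv : equiv_rel {classic dterm} := EquivRelPack deqb_equiv.

Definition Dend : Type := {eq_quot deq_equiv}.
HB.instance Definition _ := Choice.on Dend.

Definition dcl (t : dterm) : Dend := \pi_({eq_quot deq_equiv}) (t : {classic dterm}).
Definition drep (a : Dend) : dterm := repr (a : {eq_quot deq_equiv}).

Fact dcl_eq t u : deq t u -> dcl t = dcl u.
Proof. by move=> /asboolP tu; exact/(eqmodP deq_equiv). Qed.

Fact dclK a : dcl (drep a) = a.
Proof. exact: reprK. Qed.

Fact drepK t : deq (drep (dcl t)) t.
Proof. by apply/asboolP/(eqmodP deq_equiv); exact: dclK. Qed.

Definition Dadd a b := dcl (DAdd (drep a) (drep b)).
Definition Dopp a := dcl (DOpp (drep a)).
Definition Dscale c a := dcl (DScale c (drep a)).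
Definition Dprec a b := dcl (DPrec (drep a) (drep b)).
Definition Dsucc a b := dcl (DSucc (drep a) (drep b)).

Fact DaddE t u : Dadd (dcl t) (dcl u) = dcl (DAdd t u).
Proof. by apply: dcl_eq; apply: deq_add; exact: drepK. Qed.
Fact DoppE t : Dopp (dcl t) = dcl (DOpp t).
Proof. by apply: dcl_eq; apply: deq_opp; exact: drepK. Qed.
Fact DscaleE c t : Dscale c (dcl t) = dcl (DScale c t).
Proof. by apply: dcl_eq; apply: deq_scale; exact: drepK. Qed.
Fact DprecE t u : Dprec (dcl t) (dcl u) = dcl (DPrec t u).
Proof. by apply: dcl_eq; apply: deq_prec; exact: drepK. Qed.
Fact DsuccE t u : Dsucc (dcl t) (dcl u) = dcl (DSucc t u).
Proof. by apply: dcl_eq; apply: deq_succ; exact: drepK. Qed.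
Definition dclE := (DaddE, DoppE, DscaleE, DprecE, DsuccE).

Fact DaddA : associative Dadd.
Proof. by move=> a b c; rewrite -[a]dclK -[b]dclK -[c]dclK !dclE; exact/dcl_eq/deq_addA. Qed.
Fact DaddC : commutative Dadd.
Proof. by move=> a b; rewrite -[a]dclK -[b]dclK !dclE; exact/dcl_eq/deq_addC. Qed.
Fact Dadd0 : left_id (dcl DZero) Dadd.
Proof. by move=> a; rewrite -[a]dclK !dclE; exact/dcl_eq/deq_add0. Qed.
Fact DaddN : left_inverse (dcl DZero) Dopp Dadd.
Proof. by move=> a; rewrite -[a]dclK !dclE; exact/dcl_eq/deq_addN. Qed.

HB.instance Definition _ := GRing.isZmodule.Build Dend DaddA DaddC Dadd0 DaddN.

Fact DscaleA c d a : Dscale c (Dscale d a) = Dscale (c * d) a.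
Proof. by rewrite -[a]dclK !dclE; exact/dcl_eq/deq_scaleA. Qed.
Fact Dscale1 : left_id 1 Dscale.
Proof. by move=> a; rewrite -[a]dclK !dclE; exact/dcl_eq/deq_scale1. Qed.
Fact DscaleDr : right_distributive Dscale (@GRing.add Dend).
Proof.
move=> c a b; rewrite -[a]dclK -[b]dclK.
by rewrite -[LHS]/(Dscale c (Dadd _ _)) -[RHS]/(Dadd _ _) !dclE; exact/dcl_eq/deq_scaleDr.
Qed.
Fact DscaleDl a : {morph Dscale^~ a : c d / c + d >-> (c + d : Dend)}.
Proof.
move=> c d; rewrite -[a]dclK -[RHS]/(Dadd _ _) !dclE; exact/dcl_eq/deq_scaleDl.
Qed.

HB.instance Definition _ :=
  GRing.Zmodule_isLmodule.Build K Dend DscaleA Dscale1 DscaleDr DscaleDl.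

Fact Dlin c (a b : Dend) : c *: a + b = Dadd (Dscale c a) b.
Proof. by []. Qed.

Fact Dprec_linearl z : linear (fun a : Dend => Dprec a z : Dend).
Proof.
move=> c a b; rewrite -[a]dclK -[b]dclK -[z]dclK !Dlin !dclE.
exact/dcl_eq/deq_precl.
Qed.
Fact Dprec_linearr z : linear (Dprec z : Dend -> Dend).
Proof.
move=> c a b; rewrite -[a]dclK -[b]dclK -[z]dclK !Dlin !dclE.
exact/dcl_eq/deq_precr.
Qed.
Fact Dsucc_linearl z : linear (fun a : Dend => Dsucc a z : Dend).
Proof.
move=> c a b; rewrite -[a]dclK -[b]dclK -[z]dclK !Dlin !dclE.
exact/dcl_eq/deq_succl.
Qed.
Fact Dsucc_linearr z : linear (Dsucc z : Dend -> Dend).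
Proof.
move=> c a b; rewrite -[a]dclK -[b]dclK -[z]dclK !Dlin !dclE.
exact/dcl_eq/deq_succr.
Qed.
Fact Dprec_prec (a b c : Dend) :
  Dprec (Dprec a b) c = Dprec a (Dprec b c) + Dprec a (Dsucc b c) :> Dend.
Proof.
rewrite -[a]dclK -[b]dclK -[c]dclK -[RHS]/(Dadd _ _) !dclE; exact/dcl_eq/deq_dend_pp.
Qed.
Fact Dsucc_prec (a b c : Dend) : Dprec (Dsucc a b) c = Dsucc a (Dprec b c).
Proof. rewrite -[a]dclK -[b]dclK -[c]dclK !dclE; exact/dcl_eq/deq_dend_sp. Qed.
Fact Dsucc_succ (a b c : Dend) :
  Dsucc (Dprec a b) c + Dsucc (Dsucc a b) c = Dsucc a (Dsucc b c) :> Dend.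
Proof.
rewrite -[a]dclK -[b]dclK -[c]dclK -[LHS]/(Dadd _ _) !dclE; exact/dcl_eq/deq_dend_ss.
Qed.

HB.instance Definition _ := isDendriform.Build K Dend
  Dprec_linearl Dprec_linearr Dsucc_linearl Dsucc_linearr
  Dprec_prec Dsucc_prec Dsucc_succ.

Definition dgen (v : V) : Dend := dcl (DGen v).

Fact dgen_linear : linear dgen.
Proof. by move=> c v w; rewrite Dlin /dgen !dclE; exact/dcl_eq/deq_gen. Qed.

HB.instance Definition _ := GRing.isLinear.Build K V Dend _ dgen dgen_linear.

Section Lift.
Variables (B : dendType K) (f : {linear V -> B}).

Fixpoint deval (t : dterm) : B :=
  match t with
  | DGen v => f v
  | DZero => 0
  | DAdd t u => deval t + deval u
  | DOpp t => - deval t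
  | DScale c t => c *: deval t
  | DPrec t u => prec (deval t) (deval u)
  | DSucc t u => succ (deval t) (deval u)
  end.

Fact deval_eq t u : deq t u -> deval t = deval u.
Proof.
elim=> {t u} //=; do ?by move=> *; congruence.
- by move=> t u v; rewrite addrA.
- by move=> t u; rewrite addrC.
- by move=> t; rewrite add0r.
- by move=> t; rewrite addNr.
- by move=> c d t; rewrite scalerA.
- by move=> t; rewrite scale1r.
- by move=> c t u; rewrite scalerDr.
- by move=> t c d; rewrite scalerDl.
- by move=> c v w; rewrite linearP.
- by move=> z c t u; rewrite prec_linearl.
- by move=> z c t u; rewrite prec_linearr.
- by move=> z c t u; rewrite succ_linearl.
- by move=> z c t u; rewrite succ_linearr.
- by move=> t u v; rewrite dend_prec_prec.
- by move=> t u v; rewrite dend_succ_prec.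
- by move=> t u v; rewrite dend_succ_succ.
Qed.

Definition dlift (a : Dend) : B := deval (drep a).

Fact dliftE t : dlift (dcl t) = deval t.
Proof. exact/deval_eq/drepK. Qed.

Fact dlift_linear : linear dlift.
Proof. by move=> c a b; rewrite -[a]dclK -[b]dclK Dlin !dclE !dliftE. Qed.

HB.instance Definition _ := GRing.isLinear.Build K Dend B _ dlift dlift_linear.

End Lift.

Lemma free_Dend : free_dendriform (dgen : {linear V -> Dend}).
Proof.
move=> B f; exists (dlift f : {linear Dend -> B}); split.
- split=> a b /=; rewrite -[a]dclK -[b]dclK.
    by rewrite -[_ ≺ _]/(Dprec _ _) !dclE !dliftE.
  by rewrite -[_ ≻ _]/(Dsucc _ _) !dclE !dliftE.
- by move=> v /=; rewrite dliftE.
- move=> g [gp gs] gf a; rewrite -[a]dclK /= dliftE.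
  elim: (drep a) => {a} [v||t IHt u IHu|t IHt|c t IHt|t IHt u IHu|t IHt u IHu] /=.
  + exact: gf.
  + exact: linear0.
  + by rewrite -IHt -IHu -linearD -DaddE.
  + by rewrite -IHt -linearN -DoppE.
  + by rewrite -IHt -linearZ -DscaleE.
  + by rewrite -IHt -IHu -gp -DprecE.
  + by rewrite -IHt -IHu -gs -DsuccE.
Qed.

End Existence.

(* Main.v *)
(* Writing w = e(z) - 1, the series e(z) is characterised by w = z ≺ (1 + w),
   and degree by degree this equation determines w from z as well as z from w.
   Let s be the inverse of e(x), i.e. s = 1 - s ≻ x = sum_j (-1)^j x^{≻ j}. Then
   z = x + e(x) ≻ y ≺ s solves the equation for w = e(x) e(y) - 1, because
   z ≺ (e(x) e(y)) = (x ≺ e(x)) ≺ e(y) + e(x) ≻ (y ≺ (s e(x) e(y)))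
                   = (e(x) - 1) ≺ e(y) + e(x) ≻ (e(y) - 1) = w.
   The degree n part of e(x) ≻ y ≺ s is the brace product. *)

Require Import Defs.
From HB Require Import structures.
From mathcomp Require Import all_boot all_algebra zify.
From mathcomp Require Import boolp classical_sets functions.

Set Implicit Arguments.
Unset Strict Implicit.
Unset Printing Implicit Defensive.

Import GRing.Theory.
Local Open Scope ring_scope.
Local Open Scope dend_scope.

(** * Identities in a dendriform algebra with unit *)

Section Dendriform.
Variables (K : comPzRingType) (D : dendType K).
Implicit Types (a b : augmented D) (x y z u v : D).

Lemma precDl u v z : ((u + v) ≺ z) = (u ≺ z) + (v ≺ z).
Proof. by have := prec_linearl z 1 u v; rewrite !scale1r. Qed.

Lemma precZl c u z : ((c *: u) ≺ z) = c *: (u ≺ z).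
Proof. by have := prec_linearl z c u 0; rewrite prec0 !addr0. Qed.

Lemma precNl u z : ((- u) ≺ z) = - (u ≺ z).
Proof. by rewrite -!scaleN1r precZl. Qed.

Lemma precDr z u v : (z ≺ (u + v)) = (z ≺ u) + (z ≺ v).
Proof. by have := prec_linearr z 1 u v; rewrite !scale1r. Qed.

Lemma precZr z c u : (z ≺ (c *: u)) = c *: (z ≺ u).
Proof. by have := prec_linearr z c u 0; rewrite precr0 !addr0. Qed.

Lemma precNr z u : (z ≺ (- u)) = - (z ≺ u).
Proof. by rewrite -!scaleN1r precZr. Qed.

Lemma succZl c u z : ((c *: u) ≻ z) = c *: (u ≻ z).
Proof. by have := succ_linearl z c u 0; rewrite succ0 !addr0. Qed.

Lemma succDr z u v : (z ≻ (u + v)) = (z ≻ u) + (z ≻ v).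
Proof. by have := succ_linearr z 1 u v; rewrite !scale1r. Qed.

Lemma precU1E z u : precU z (1, u) = z + (z ≺ u).
Proof. by rewrite /precU scale1r. Qed.

Lemma succU1E u z : succU (1, u) z = z + (u ≻ z).
Proof. by rewrite /succU scale1r. Qed.

Lemma precUDl u v b : precU (u + v) b = precU u b + precU v b.
Proof. by rewrite /precU scalerDr precDl addrACA. Qed.

(** The first dendriform axiom, extended to the unit: ≺ is a right action of the associative
    product. *)
Lemma precU_amul z a b : precU (precU z a) b = precU z (amul a b).
Proof.
rewrite /precU /amul /= precDl precZl dend_prec_prec !precDr !precZr.
by rewrite scalerDr scalerA [b.1 * _]mulrC !addrA; congr (_ + _ + _); rewrite addrAC.
Qed.

(** Expanding the left factor of u ≺ v and the right factor of u ≻ v by their own equations makes u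
    + v + u ≺ v + u ≻ v cancel. *)
Lemma amul_left_inverse z u v :
  u = - succU (1, u) z -> v = precU z (1, v) -> amul (1, u) (1, v) = aone.
Proof.
rewrite succU1E precU1E => uE vE; congr pair; rewrite ?mulr1 //= !scale1r.
have -> : (u ≺ v) = - (z ≺ v) - (u ≻ (z ≺ v)).
  by rewrite {1}uE precNl precDl dend_succ_prec opprD.
have -> : (u ≻ v) = (u ≻ z) + (u ≻ (z ≺ v)) by rewrite {1}vE succDr.
move: (z ≺ v) (u ≻ z) (u ≻ (z ≺ v)) uE vE => p q r -> ->.
rewrite [- p - r + _]addrACA addNr addr0 opprD [z + p + _]addrACA subrr add0r.
by rewrite addrACA subrr addNr addr0.
Qed.

(* [(1, u)] and [(1, v)] play the roles of e(x) and e(y), and [(1, s)] that of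
   e(x)^-1; the conclusion is the fixed-point equation of e(z). *)
Lemma exp_mul_fixpoint x y u v s :
  u = precU x (1, u) -> v = precU y (1, v) -> s = - succU (1, s) x ->
  let w := (amul (1, u) (1, v)).2 in
  w = precU (x + midU (1, u) y (1, s)) (1, w).
Proof.
move=> uE vE sE w.
have -> : (1, w) = amul (1, u) (1, v) :> augmented D by rewrite /w /amul /= mulr1.
rewrite precUDl -!precU_amul /midU [precU (precU _ (1, s)) _]precU_amul.
rewrite (amul_left_inverse sE uE) -uE.
have -> : precU (succU (1, u) y) aone = succU (1, u) y by rewrite precU1E precr0 addr0.
rewrite -/(midU (1, u) y (1, v)) midU_assoc -vE precU1E succU1E /w /= !scale1r.
by rewrite [v + u]addrC addrACA.
Qed.

End Dendriform.

(** * Fixed-point equations in the completion *)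

Section Series.
Variables (K : comPzRingType) (V : lmodType K) (A : dendType K).
Variable iota : {linear V -> A}.
Local Notation compl := (completion iota).
Implicit Types (a z w : compl) (v x y : V).

Lemma component0 a : a 0%N = 0.
Proof. exact/homog0/component_homog. Qed.

(** As [z] starts in degree 1, degree n of z ≺ a sees only components of [a] below n. *)
Lemma cprec_fixpoint0 z a : a = (z ≺ a) -> a = 0.
Proof.
move=> aE; apply: completion_eq => n; elim/ltn_ind: n => n IHn.
rewrite aE /= /conv big1 // => i _.
have [->|i_gt0] := posnP i; first by rewrite component0 prec0.
rewrite IHn ?precr0 // ltn_subrL i_gt0 /=.
by apply: leq_trans i_gt0 _; rewrite -ltnS.
Qed.

(** The difference a satisfies a + a ≺ w = 0, and [w] starts in degree 1, so a vanishes degree by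
    degree. This makes logarithms unique. *)
Lemma precU1_inj w z z' : precU z (1, w) = precU z' (1, w) -> z = z'.
Proof.
move=> zz'; apply/eqP; rewrite -subr_eq0; apply/eqP.
have : precU (z - z') (1, w) = 0.
  by rewrite precU1E precDl precNl addrACA -opprD -!precU1E zz' subrr.
rewrite precU1E; move: (z - z') => a aE; apply: completion_eq.
elim/ltn_ind => n IHn; have := congr1 (fun b : compl => b n) aE.
rewrite componentD /= /conv big1 ?addr0 // => i _.
have [ni|] := leqP n i; first by rewrite (eqP ni) component0 precr0.
by move=> /IHn ->; rewrite prec0.
Qed.

Lemma dexp_fixpoint z : (dexp z).2 = precU z (dexp z).
Proof.
rewrite precU1E; apply: completion_eq => n.
have low m d : (d < m)%N -> (precpow z m).2 d = 0 by exact: precpow_low.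
(* The partial sum has one term more than degree n needs: with the first term split off and the
   index shifted, the tail still runs up to n. *)
rewrite -[LHS](infsumE low (leqnSn n)) big_ltn // big_add1 [LHS]componentD [RHS]componentD.
congr (_ + _); first by rewrite [(precpow z 1).2]precU1E precr0 addr0.
transitivity ((z ≺ \sum_(1 <= m < n.+1) (precpow z m).2) n).
  rewrite (big_morph (prec z) (precDr z) (precr0 z)); congr (component _ n).
  by apply: eq_big_nat => -[|m] // _; rewrite /= /precU scale0r add0r.
by apply: eq_bigr => i _; rewrite (infsumE low) // leq_subr.
Qed.

Lemma dexp_unique z w : w = precU z (1, w) -> dexp z = (1, w).
Proof.
move=> wE; congr pair; apply/eqP; rewrite -subr_eq0; apply/eqP.
apply: (@cprec_fixpoint0 z); rewrite precDr precNr.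
rewrite {1}wE -[X in X - _]/((dexp z).2) dexp_fixpoint !precU1E.
by rewrite opprD addrACA subrr add0r.
Qed.

Lemma cgen_prec v a n : (cgen iota v ≺ a) n.+1 = (iota v ≺ a n).
Proof.
rewrite /= /conv big_ord_recl prec0 add0r big_ord_recl /= subSS subn0.
by rewrite big1 ?addr0 // => i _; rewrite prec0.
Qed.

Lemma succ_cgen a v n : (a ≻ cgen iota v) n.+1 = (a n ≻ iota v).
Proof.
rewrite /= /conv big_ord_recr /= subnn succr0 addr0 big_ord_recr /= subSnn /=.
rewrite big1 ?add0r // => i _; case: eqP; rewrite ?succr0 //.
by have := ltn_ord i; lia.
Qed.

Lemma precpow1 (D : dendType K) (u : D) n : (precpow u n).1 = (n == 0%N)%:R.
Proof. by case: n. Qed.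

Lemma succpow1 (D : dendType K) (u : D) n : (succpow u n).1 = (n == 0%N)%:R.
Proof. by case: n. Qed.

Lemma cgen_component v n : cgen iota v n.+1 = (n == 0%N)%:R *: iota v.
Proof. by case: n => [|n] /=; rewrite ?scale1r ?scale0r. Qed.

(** Multiplication by a generator shifts degrees by one, so the fixed-point equation becomes the
    recursion of [precpow]. *)
Lemma dexp_cgen v n : (dexp (cgen iota v)).2 n = (precpow (iota v) n).2.
Proof.
elim: n => [|n IHn]; first exact: component0.
rewrite dexp_fixpoint precU1E componentD cgen_prec IHn cgen_component.
by rewrite /= /precU precpow1.
Qed.

Lemma succpow_homog v n : homog iota n (succpow (iota v) n).2.
Proof.
elim: n => [|n IHn]; first exact: homog_zero.
rewrite /= /succU succpow1 -addn1; apply: homog_add.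
  case: n {IHn} => [|n]; first by rewrite scale1r; exact: homog_gen.
  by rewrite scale0r; exact: homog_zero.
by apply: homog_succ IHn _; exact: homog_gen.
Qed.

Fact inv_exp_subproof v :
  (fun n => (-1) ^+ n *: (succpow (iota v) n).2) \in graded_series iota.
Proof. by apply/graded_seriesP => n; apply/homog_scale/succpow_homog. Qed.

(* [(1, inv_exp v)] is the inverse of e(v). *)
Definition inv_exp v : compl := Completion (inv_exp_subproof v).

Lemma inv_exp_fixpoint v : inv_exp v = - succU (1, inv_exp v) (cgen iota v).
Proof.
apply: completion_eq => -[|n]; first by rewrite !component0.
rewrite succU1E -scaleN1r componentZ componentD succ_cgen cgen_component.
rewrite /= /succU succpow1 succZl exprS -scalerA; congr (_ *: _).
by rewrite scalerDr; case: n => [|n]; rewrite ?expr0 ?scale1r ?scale0r ?scaler0.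
Qed.

(** The candidate for y + H_2 + H_3 + ..., with y as its degree 1 part. *)
Definition bch x y : compl := midU (dexp (cgen iota x)) (cgen iota y) (1, inv_exp x).

Lemma bchE x y n :
  bch x y n.+1 = \sum_(i < n.+1)
    (-1) ^+ (n - i) *: midU (precpow (iota x) i) (iota y) (succpow (iota x) (n - i)).
Proof.
have tE k : succU (dexp (cgen iota x)) (cgen iota y) k.+1
    = succU (precpow (iota x) k) (iota y).
  rewrite succU1E componentD succ_cgen cgen_component dexp_cgen.
  by rewrite /succU precpow1.
rewrite /bch /midU precU1E; move: (succU _ _) tE => t tE.
rewrite componentD /= /conv.
(* The summand i = n comes from the unit of the inverse series, the others from its components of
   positive degree. *)
rewrite big_ord_recl component0 prec0 add0r !big_ord_recr /=.
rewrite tE subSS subnn expr0 !scale1r precr0 addr0 addrC; congr (_ + _);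
  first by rewrite precU1E precr0 addr0.
apply: eq_bigr => i _; rewrite tE subSS /precU succpow1 precZr.
by rewrite subn_eq0 leqNgt ltn_ord scale0r add0r.
Qed.

Lemma bch_exp x y :
  amul (dexp (cgen iota x)) (dexp (cgen iota y)) = dexp (cgen iota x + bch x y).
Proof.
rewrite (dexp_unique (exp_mul_fixpoint (dexp_fixpoint _) (dexp_fixpoint _)
  (inv_exp_fixpoint x))).
by rewrite /amul /= mulr1.
Qed.

Lemma bch_decomp x y (H : nat -> A) (hH : forall n, (2 <= n)%N -> homog iota n (H n)) :
  (cgen iota x + cgen iota y + series_ge2 hH = cgen iota x + bch x y) <->
  (forall n, (2 <= n)%N -> H n = bch x y n).
Proof.
rewrite -addrA; split=> [/addrI bE [|[|n]] // _|HE].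
  by rewrite -bE componentD cgen_component scale0r add0r.
congr (_ + _); apply: completion_eq => -[|[|n]]; first by rewrite !component0.
  rewrite componentD cgen_component bchE big_ord_recl big_ord0 /=.
  by rewrite !addr0 subnn expr0 /midU /precU /succU /= !scale1r succ0 precr0 !addr0.
by rewrite componentD cgen_component scale0r add0r /= HE.
Qed.

(** Equal exponentials have equal exponents by [precU1_inj], applied to their common fixed-point
    equation. This yields both existence and uniqueness of H. *)
Lemma is_BCH_iff x y (H : nat -> A) :
  is_BCH iota x y H <-> forall n, (2 <= n)%N -> H n = bch x y n.
Proof.
split=> [[hH HE]|HE].
  apply/(bch_decomp _ _ hH); move: HE; rewrite bch_exp => HE.
  have e2 := congr1 snd HE.
  by apply: (@precU1_inj (dexp (cgen iota x + bch x y)).2);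
     rewrite {1}e2 -!dexp_fixpoint e2.
have hH n : (2 <= n)%N -> homog iota n (H n) by move=> /HE ->; exact: component_homog.
by exists hH; rewrite bch_exp; congr dexp; apply/esym/bch_decomp.
Qed.

End Series.

Section Brace.
Variables (K : comPzRingType) (D : dendType K).

Lemma prec_nest_nseq (u : D) n : prec_nest (nseq n u) = precpow u n.
Proof. by elim: n => //= n ->. Qed.

Lemma succ_nest_nseq (u : D) n : succ_nest (nseq n u) = succpow u n.
Proof.
(* [succpow] multiplies on the right, so the last letter is split off. *)
elim: n => // n IHn; rewrite -addn1 nseqD /succ_nest foldl_cat.
by rewrite -/(succ_nest _) IHn addn1.
Qed.

Lemma brace_nseq (u y : D) n :
  brace (nseq n u) y =
  \sum_(i < n.+1) (-1) ^+ (n - i) *: midU (precpow u i) y (succpow u (n - i)).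
Proof.
rewrite /brace size_nseq; apply: eq_bigr => i _.
by rewrite take_nseq ?drop_nseq ?prec_nest_nseq ?succ_nest_nseq // -ltnS.
Qed.

End Brace.

Lemma sum_antidiagonal (M : nmodType) (F : nat -> nat -> M) n :
  \sum_(i < n.+1) \sum_(j < n.+1 | (i + j == n)%N) F i j
  = \sum_(i < n.+1) F i (n - i)%N.
Proof.
apply: eq_bigr => i _; rewrite (big_pred1 (inord (n - i))) /=.
  by rewrite inordK // ltnS leq_subr.
move=> j; rewrite /= -val_eqE /= inordK ?ltnS ?leq_subr //.
by have := ltn_ord i; lia.
Qed.

Theorem corollary3p2 (K : comPzRingType) (V : lmodType K) (x y : V)
    (A : dendType K) (iota : {linear V -> A}) :
  free_module_on2 x y ->
  free_dendriform iota ->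
  (exists H : nat -> A, is_BCH iota x y H) /\
  (forall H : nat -> A, is_BCH iota x y H ->
     forall n : nat, (2 <= n)%N ->
       H n = \sum_(i < n) \sum_(j < n | (i + j == n.-1)%N)
               (-1) ^+ j *: midU (precpow (iota x) i) (iota y) (succpow (iota x) j)
       /\
       \sum_(i < n) \sum_(j < n | (i + j == n.-1)%N)
               (-1) ^+ j *: midU (precpow (iota x) i) (iota y) (succpow (iota x) j)
         = brace (nseq n.-1 (iota x)) (iota y)).
Proof.
move=> _ _; split; first by exists (bch iota x y); apply/is_BCH_iff.
(* In degree [n.+1] all the expressions become the sum over i ≤ n with j = n - i. *)
move=> H /is_BCH_iff HE [//|n] n_ge2; rewrite HE // bchE brace_nseq.
by rewrite (sum_antidiagonal (fun i j => (-1) ^+ j *: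
  midU (precpow (iota x) i) (iota y) (succpow (iota x) j))).
Qed.
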